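(* Let $\mathcal{H}$ be a real Hilbert space, let $\phi:\mathcal{H}\to\mathbb{R}$ be convex and continuous, and let the operators $U_1,\dots,U_m$, the number $\rho_U$, the string-averaging operators $T_{(\Omega_k,\omega_k)}$ ($k\in\mathbb{N}$), the set $I$, the sets $C_T$ ($T\in I$) and the set $C$ be as defined in the context. Let $y^0\in\mathcal{H}$. Assume that the sequence $\{T_{(\Omega_k,\omega_k)}\}_{k=0}^\infty$ is $\limsup$-admissible and $C\ne\emptyset$. Let $\varepsilon>0$ and let $\{\lambda_k\}_{k=0}^\infty$ be a sequence of real numbers with $\lambda_k\in[\varepsilon,1+\rho_U-\varepsilon]$ for each $k\in\mathbb{N}$. Then any sequence $\{y^k\}_{k=0}^\infty$ generated by the superiorized GDSA algorithm (described in the context) from $y^0$ with respect to $\phi$ and $\{\lambda_k\}_{k=0}^\infty$ converges weakly to a point $y\in C$. If, in addition, each $T\in I$ is approximately shrinking and the family $\{C_T\}_{T\in I}$ is boundedly regular, then $\{y^k\}_{k=0}^\infty$ converges strongly to a point $y\in C$.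
   Context: $\mathbb{N}=\{0,1,2,\dots\}$; $Id$ is the identity on the real Hilbert space $\mathcal{H}$; $\mathrm{Fix}\,T=\{x\in\mathcal{H}: T(x)=x\}$; $d(x,A)=\inf_{y\in A}\|x-y\|$; $\partial\phi(x)=\{g\in\mathcal{H}:\langle g,y-x\rangle\le\phi(y)-\phi(x)\ \text{for all } y\in\mathcal{H}\}$ (nonempty for every $x$ when $\phi$ is convex and continuous). Operators. An operator $T:\mathcal{H}\to\mathcal{H}$ is firmly nonexpansive if $\langle T(x)-T(y),x-y\rangle\ge\|T(x)-T(y)\|^2$ for all $x,y\in\mathcal{H}$. For $\lambda\in[0,2]$, the $\lambda$-relaxation of $T$ is $T_\lambda:=(1-\lambda)Id+\lambda T$. An operator is $\lambda$-relaxed firmly nonexpansive if it is the $\lambda$-relaxation of a firmly nonexpansive operator. An operator $T$ is quasi-nonexpansive if $\|T(x)-z\|\le\|x-z\|$ for all $x\in\mathcal{H}$, $z\in\mathrm{Fix}\,T$. A quasi-nonexpansive operator $T$ is approximately shrinking if for each bounded sequence $\{x^k\}$ in $\mathcal{H}$, $\lim_k\|T(x^k)-x^k\|=0$ implies $\lim_k d(x^k,\mathrm{Fix}\,T)=0$. String-averaging setting. Let $m$ be a positive integer and, for $i=1,\dots,m$, let $\alpha_i\in(0,2]$ and let $U_i:\mathcal{H}\to\mathcal{H}$ be $\alpha_i$-relaxed firmly nonexpansive. Let $\{q_k\}_{k=0}^\infty$ be a bounded sequence of positive integers, $\mathcal{M}:=\max_{k}q_k$, and $$\rho_U:=\min\Big\{\mathcal{M}^{-1}\min_{1\le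 i\le m}(2-\alpha_i)\alpha_i^{-1},\,1\Big\}.$$ For each $k\in\mathbb{N}$ let $\Omega_k$ be a nonempty set of functions from $\{1,\dots,q_k\}$ to $\{1,\dots,m\}$, let $\omega_k:\Omega_k\to(0,1]$ satisfy $\sum_{t\in\Omega_k}\omega_k(t)=1$, and set, for $t\in\Omega_k$, $V_k[t]:=U_{t(q_k)}\cdots U_{t(2)}U_{t(1)}$ (composition) and $T_{(\Omega_k,\omega_k)}:=\sum_{t\in\Omega_k}\omega_k(t)V_k[t]$. Put $$I:=\limsup_{k\to\infty}\{T_{(\Omega_k,\omega_k)}\}=\bigcap_{n=0}^\infty\bigcup_{k=n}^\infty\{T_{(\Omega_k,\omega_k)}\},$$ i.e. the set of operators equal to $T_{(\Omega_k,\omega_k)}$ for infinitely many $k$; $C_T:=\mathrm{Fix}\,T$ for $T\in I$; and $C:=\bigcap_{T\in I}C_T$. A sequence $\{T_k\}_{k=0}^\infty$ of operators $T_k:\mathcal{H}\to\mathcal{H}$ is $\limsup$-admissible if every $T_k$ belongs to $\limsup_{k\to\infty}\{T_k\}$ and for each $T\in\limsup_{k\to\infty}\{T_k\}$ there is an integer $M_T>0$ such that $T\in\{T_k,T_{k+1},\dots,T_{k+M_T-1}\}$ for all $k\in\mathbb{N}$. Bounded regularity. A family $\{C_i\}_{i\in J}$ ($J\ne\emptyset$) of nonempty, closed and convex subsets of $\mathcal{H}$ with nonempty intersection $D$ is boundedly regular if for any bounded sequence $\{x^k\}$ in $\mathcal{H}$, $\lim_k d(x^k,C_i)=0$ for each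 $i\in J$ implies $\lim_k d(x^k,D)=0$. Superiorized GDSA algorithm. Given $y^0\in\mathcal{H}$, a sequence $\{N_k\}_{k=0}^\infty$ of positive integers, positive numbers $\lambda_k$ ($k\in\mathbb{N}$), and positive reals $\beta_{k,n}$ ($k\in\mathbb{N}$, $1\le n\le N_k$) with $\sum_{k=0}^\infty\sum_{n=1}^{N_k}\beta_{k,n}<\infty$, the algorithm is, for each $k\in\mathbb{N}$, $$y^{k+1}:=w^k+\lambda_k\left(T_{(\Omega_k,\omega_k)}(w^k)-w^k\right),\qquad w^k:=y^k+\sum_{n=1}^{N_k}\beta_{k,n}v^{k,n},$$ where for $n=0,1,\dots,N_k-1$, with $y^{k,n}:=y^k+\sum_{i=1}^n\beta_{k,i}v^{k,i}$ (empty sum $=0$) and $s^{k,n}$ a selection from $\partial\phi(y^{k,n})$, one sets $v^{k,n+1}:=-\|s^{k,n}\|^{-1}s^{k,n}$ if $0\notin\partial\phi(y^{k,n})$ and $v^{k,n+1}:=0$ if $0\in\partial\phi(y^{k,n})$. *)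

(* Defs.v *)
From HB Require Import structures.
From mathcomp Require Import all_boot all_order all_algebra.
From mathcomp Require Import all_classical all_reals all_analysis.

Set Implicit Arguments.
Unset Strict Implicit.
Unset Printing Implicit Defensive.

Import Order.TTheory GRing.Theory Num.Theory.
Import numFieldNormedType.Exports.

Local Open Scope classical_set_scope.
Local Open Scope ring_scope.

(* A real Hilbert space is a complete normed space [H] together with a symmetric
   positive definite bilinear form that induces its norm. *)
Definition induces_norm (R : realType) (H : completeNormedModType R)
    (ip : {dot H for idfun}) : Prop :=
  forall x : H, `|x| ^+ 2 = ip x x.

Section metric_notions.
Context {R : realType} {H : completeNormedModType R}.

Definition Fix (T : H -> H) : set H := [set x | T x = x].

(* Extended-real valued, so that the distance to the empty set is +oo. *)
Definition dist_set (x : H) (A : set H) : \bar R :=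
  ereal_inf [set `|x - y|%:E | y in A].

Definition quasi_nonexpansive (T : H -> H) : Prop :=
  forall x z, Fix T z -> `|T x - z| <= `|x - z|.

Definition approximately_shrinking (T : H -> H) : Prop :=
  quasi_nonexpansive T /\
  forall x : nat -> H, bounded_fun x ->
    `|T (x k) - x k| @[k --> \oo] --> (0 : R) ->
    dist_set (x k) (Fix T) @[k --> \oo] --> 0%E.

Definition boundedly_regular {Idx : Type} (J : set Idx) (F : Idx -> set H) :
    Prop :=
  [/\ J !=set0,
      forall i, J i -> [/\ F i !=set0, closed (F i) & convex_set (F i)],
      \bigcap_(i in J) F i !=set0 &
      forall x : nat -> H, bounded_fun x ->
        (forall i, J i -> dist_set (x k) (F i) @[k --> \oo] --> 0%E) ->
        dist_set (x k) (\bigcap_(i in J) F i) @[k --> \oo] --> 0%E].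

Definition relaxation (lambda : R) (T : H -> H) : H -> H :=
  fun x => (1 - lambda) *: x + lambda *: T x.

Definition limsup_op (T : nat -> H -> H) : set (H -> H) :=
  lim_sup_set (fun k => [set T k]).

Definition limsup_admissible (T : nat -> H -> H) : Prop :=
  (forall k, limsup_op T (T k)) /\
  (forall S, limsup_op T S ->
     exists2 M : nat, (0 < M)%N &
       forall k, exists2 j, (k <= j < k + M)%N & S = T j).

End metric_notions.

Section inner_product_notions.
Context {R : realType} {H : completeNormedModType R} (ip : {dot H for idfun}).

Definition firmly_nonexpansive (T : H -> H) : Prop :=
  forall x y, ip (T x - T y) (x - y) >= `|T x - T y| ^+ 2.

Definition relaxed_firmly_nonexpansive (lambda : R) (T : H -> H) : Prop :=
  exists2 S, firmly_nonexpansive S & T = relaxation lambda S.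

Definition subdifferential (phi : H -> R) (x : H) : set H :=
  [set g | forall y, ip g (y - x) <= phi y - phi x].

(* By the Riesz representation, the functionals [ip ^~ z] are all the continuous
   linear ones. *)
Definition weakly_converges (x : nat -> H) (l : H) : Prop :=
  forall z, ip (x k) z @[k --> \oo] --> ip l z.

End inner_product_notions.

Section string_averaging.
Context {R : realType} {H : completeNormedModType R}.
(* The m of the text is [m.+1] here, so that there is at least one operator. *)
Variables (m : nat) (U : 'I_m.+1 -> H -> H).

(* [enum 'I_q] is increasing and [foldl] applies [U (t j)] for j = 0 first, so
   this is U_{t(q-1)} o ... o U_{t(0)} (indices starting from 0). *)
Definition string_op (q : nat) (t : {ffun 'I_q -> 'I_m.+1}) : H -> H :=
  fun x => foldl (fun z j => U (t j) z) x (enum 'I_q).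

Definition string_avg (q : nat) (Omega : {set {ffun 'I_q -> 'I_m.+1}})
    (omega : {ffun 'I_q -> 'I_m.+1} -> R) : H -> H :=
  fun x => \sum_(t in Omega) omega t *: string_op t x.

End string_averaging.

(* The existence of such an [M] is the boundedness of [q]. *)
Definition is_max (q : nat -> nat) (M : nat) : Prop :=
  (forall k, (q k <= M)%N) /\ (exists k, q k = M).

(* The default element of the iterated minimum is one of the terms, so this is
   the minimum over the nonempty index set. *)
Definition rho_U (R : realType) (m : nat) (alpha : 'I_m.+1 -> R) (M : nat) : R :=
  let c i := (2 - alpha i) / alpha i in
  Num.min (M%:R^-1 * \big[Num.min/c ord0]_(i < m.+1) c i) 1.

Section superiorization.
Context {R : realType} {H : completeNormedModType R} (ip : {dot H for idfun}).

Definition inner_iterate (beta : nat -> nat -> R) (v : nat -> nat -> H)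
    (y : nat -> H) (k n : nat) : H :=
  y k + \sum_(1 <= i < n.+1) beta k i *: v k i.

(* [beta k n] and [v k n] are used for 1 <= n <= N k only, [s k n] for n < N k. *)
Definition superiorized_GDSA_run (phi : H -> R) (T : nat -> H -> H)
    (lambda : nat -> R) (y0 : H) (N : nat -> nat) (beta : nat -> nat -> R)
    (s v : nat -> nat -> H) (y : nat -> H) : Prop :=
  y 0 = y0 /\
  forall k,
    (forall n, (n < N k)%N ->
       let D := subdifferential ip phi (inner_iterate beta v y k n) in
       [/\ D (s k n),
           ~ D 0 -> v k n.+1 = - (`|s k n|^-1 *: s k n) &
           D 0 -> v k n.+1 = 0]) /\
    (let w := inner_iterate beta v y k (N k) in
     y k.+1 = w + lambda k *: (T k w - w)).

Definition superiorized_GDSA (phi : H -> R) (T : nat -> H -> H)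
    (lambda : nat -> R) (y0 : H) (y : nat -> H) : Prop :=
  exists (N : nat -> nat) (beta : nat -> nat -> R) (s v : nat -> nat -> H),
    [/\ forall k, (0 < N k)%N,
        forall k n, (1 <= n <= N k)%N -> 0 < beta k n,
        cvgn (series (fun k => \sum_(1 <= n < (N k).+1) beta k n)) &
        superiorized_GDSA_run phi T lambda y0 N beta s v y].

End superiorization.

(* Main.v *)
(* The composition of q operators U_i, and any convex combination of such
   compositions, satisfies
     |T x - T y|^2 <= |x - y|^2 - rho |(x - T x) - (y - T y)|^2
   with rho = rho_U; bounding pairs of points, rather than distances to fixed
   points, makes this survive composition when the U_i share no fixed point.
   The inner superiorization steps move y^k by at most b_k = \sum_n beta_{k,n},
   which is summable, so |y^{k+1} - z| <= |y^k - z| + b_k for z in C, and comparing squares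
   gives |T_k w^k - w^k| -> 0 and |y^{k+1} - y^k| -> 0. Since each S in I recurs
   with bounded gaps and is nonexpansive, |S y^k - y^k| -> 0. Weak cluster points
   (taken along ultrafilters, where bounded sequences converge weakly by the Riesz
   representation) are then fixed by S, and Opial's argument gives weak
   convergence. Under bounded regularity d(y^k, C) -> 0, and quasi-Fejer
   monotonicity makes y^k Cauchy. *)
Require Import Defs.
From mathcomp Require Import all_boot all_order all_algebra.
From mathcomp Require Import all_classical all_reals all_analysis.
From mathcomp Require Import ring lra.

Set Implicit Arguments.
Unset Strict Implicit.
Unset Printing Implicit Defensive.

Import Order.TTheory GRing.Theory Num.Theory.
Import numFieldNormedType.Exports.

Local Open Scope classical_set_scope.
Local Open Scope ring_scope.

(** * Inner product identities and convexity of the squared norm *)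

Section inner_product.
Context {R : realType} {H : completeNormedModType R} (ip : {dot H for idfun}).
Hypothesis h_ip : induces_norm ip.
Implicit Types x y z : H.

Lemma ipC x y : ip x y = ip y x.
Proof. by rewrite hermC /= expr0 mul1r. Qed.

Lemma ipDl x y z : ip (x + y) z = ip x z + ip y z.
Proof. exact: linearDl. Qed.

Lemma ipBl x y z : ip (x - y) z = ip x z - ip y z.
Proof. exact: linearBl. Qed.

Lemma ipZl a x z : ip (a *: x) z = a * ip x z.
Proof. exact: linearZl_LR. Qed.

Lemma ip_suml (I : Type) (r : seq I) (P : pred I) (F : I -> H) z :
  ip (\sum_(i <- r | P i) F i) z = \sum_(i <- r | P i) ip (F i) z.
Proof. exact: linear_sumlz. Qed.

Lemma ipDr x y z : ip z (x + y) = ip z x + ip z y.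
Proof. by rewrite !(ipC z) ipDl. Qed.

Lemma ipBr x y z : ip z (x - y) = ip z x - ip z y.
Proof. by rewrite !(ipC z) ipBl. Qed.

Lemma ipZr a x z : ip z (a *: x) = a * ip z x.
Proof. by rewrite !(ipC z) ipZl. Qed.

Lemma sqnormD x y : `|x + y| ^+ 2 = `|x| ^+ 2 + 2 * ip x y + `|y| ^+ 2.
Proof. rewrite !h_ip ipDl !ipDr (ipC y x); ring. Qed.

Lemma sqnormB x y : `|x - y| ^+ 2 = `|x| ^+ 2 - 2 * ip x y + `|y| ^+ 2.
Proof. rewrite !h_ip ipBl !ipBr (ipC y x); ring. Qed.

Lemma sqnormZ a x : `|a *: x| ^+ 2 = a ^+ 2 * `|x| ^+ 2.
Proof. by rewrite !h_ip ipZl ipZr mulrA -expr2. Qed.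

Lemma cauchy_schwarz x y : `|ip x y| <= `|x| * `|y|.
Proof.
have [->|y0] := eqVneq y 0.
  by rewrite -(scale0r 0) ipZr mul0r normr0 mulr_ge0.
have ny : 0 < `|y| ^+ 2 by rewrite exprn_gt0 // normr_gt0.
rewrite -(@ler_pXn2r _ 2) ?nnegrE ?mulr_ge0 // exprMn real_normK ?num_real //.
(* The vector is |y|^2 times the component of [x] orthogonal to [y]; this scaling avoids a
   division. *)
have := sqr_ge0 `|(`|y| ^+ 2) *: x - ip x y *: y|.
rewrite sqnormB !sqnormZ ipZl ipZr -(pmulr_rge0 _ ny).
set a := `|x| ^+ 2; set b := `|y| ^+ 2 in ny *; set c := ip x y.
have -> : b * (b ^+ 2 * a - 2 * (b * (c * c)) + c ^+ 2 * b) =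
  b ^+ 2 * (a * b - c ^+ 2) by ring.
by rewrite pmulr_rge0 ?subr_ge0 //; apply: exprn_gt0.
Qed.

(* The variance identity: the right-hand side minus the left-hand side is the
   weighted sum of [`|F i - \sum_i p i *: F i| ^+ 2]. *)
Lemma sqnorm_convex_sum (I : finType) (A : {set I}) (p : I -> R) (F : I -> H) :
  (forall i, i \in A -> 0 <= p i) -> \sum_(i in A) p i = 1 ->
  `|\sum_(i in A) p i *: F i| ^+ 2 <= \sum_(i in A) p i * `|F i| ^+ 2.
Proof.
move=> p0 p1; set b := \sum_(i in A) _.
have : 0 <= \sum_(i in A) p i * `|F i - b| ^+ 2.
  by apply: sumr_ge0 => i iA; rewrite mulr_ge0 ?p0 ?sqr_ge0.
have -> : \sum_(i in A) p i * `|F i - b| ^+ 2 =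
   \sum_(i in A) p i * `|F i| ^+ 2 - 2 * \sum_(i in A) p i * ip (F i) b
   + (\sum_(i in A) p i) * `|b| ^+ 2.
  rewrite mulr_sumr mulr_suml -sumrB -big_split /=; apply: eq_bigr => i _.
  by rewrite sqnormB; ring.
have -> : \sum_(i in A) p i * ip (F i) b = `|b| ^+ 2.
  by rewrite h_ip {2}/b ip_suml; apply: eq_bigr => i _; rewrite ipZl.
rewrite p1; lra.
Qed.

End inner_product.

(** * Averaged operators: relaxations, strings and convex combinations *)

Section averaged_operators.
Context {R : realType} {H : completeNormedModType R} (ip : {dot H for idfun}).
Hypothesis h_ip : induces_norm ip.
Implicit Types (x y z : H) (T : H -> H).

(* For [rho > 0] this says that [T] is [(1 + rho)^-1]-averaged. *)
Definition rho_averaged (rho : R) T :=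
  forall x y, `|T x - T y| ^+ 2 <=
    `|x - y| ^+ 2 - rho * `|(x - T x) - (y - T y)| ^+ 2.

Lemma rho_averaged_le (rho rho' : R) T :
  rho' <= rho -> rho_averaged rho T -> rho_averaged rho' T.
Proof.
move=> le_rho rT x y; apply: le_trans (rT x y) _.
by rewrite lerD2l lerN2 ler_wpM2r // sqr_ge0.
Qed.

Lemma rho_averaged_nonexpansive (rho : R) T x y :
  0 <= rho -> rho_averaged rho T -> `|T x - T y| <= `|x - y|.
Proof.
move=> rho0 rT; rewrite -(@ler_pXn2r _ 2) ?nnegrE //.
by apply: le_trans (rT x y) _; rewrite gerBl mulr_ge0 ?sqr_ge0.
Qed.

(** With [d] the difference of the displacements of [S], the right-hand side exceeds the left by
    [2 * alpha * (c - b)], and [b <= c] is firm nonexpansiveness. *)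
Lemma relaxed_rho_averaged (alpha : R) T : 0 < alpha ->
  relaxed_firmly_nonexpansive ip alpha T ->
  rho_averaged ((2 - alpha) / alpha) T.
Proof.
move=> alpha0 [S fS ->] x y; set d := (S x - S y) - (x - y).
have relE u : relaxation alpha S u = u + alpha *: (S u - u).
  by rewrite /relaxation scalerBl scale1r scalerBr addrAC addrA.
have dE : alpha *: (S x - x) - alpha *: (S y - y) = alpha *: d.
  by rewrite -scalerBr /d !opprD !opprK addrACA.
have subDK (u v : H) : u - (u + v) = - v by rewrite opprD addrA subrr add0r.
rewrite !relE.
have -> : x + alpha *: (S x - x) - (y + alpha *: (S y - y)) =
    (x - y) + alpha *: d by rewrite -dE opprD addrACA.
have -> : x - (x + alpha *: (S x - x)) - (y - (y + alpha *: (S y - y))) =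
    - (alpha *: d) by rewrite -dE !subDK -opprD.
rewrite normrN (sqnormD h_ip) !(sqnormZ h_ip) ipZr.
have -> : (2 - alpha) / alpha * (alpha ^+ 2 * `|d| ^+ 2) =
    (2 - alpha) * alpha * `|d| ^+ 2 by field; rewrite gt_eqF.
have -> : ip (x - y) d = ip (S x - S y) (x - y) - `|x - y| ^+ 2.
  by rewrite /d ipBr (h_ip (x - y)) (ipC _ (x - y)).
rewrite [`|d| ^+ 2](sqnormB h_ip); have := fS x y.
set a := `|x - y| ^+ 2; set b := `|S x - S y| ^+ 2; set c := ip _ _ => bc.
nra.
Qed.

(** Inductive step for bounding the square of a sum by the number of terms times the sum of squares:
    [E] stands for [n] terms, [g] for the sum of their squares. It follows from (n D - E)^2 >= 0;
    for n = 0 the hypothesis forces [E = 0]. *)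
Lemma sqrD_le_weighted (D E g : R) n : 0 <= g -> E ^+ 2 <= n%:R * g ->
  (D + E) ^+ 2 <= n.+1%:R * (D ^+ 2 + g).
Proof.
case: n => [|n] g0 Eg.
  have /eqP -> : E == 0 by rewrite -sqrf_eq0 eq_le sqr_ge0 andbT -(mul0r g).
  by rewrite addr0 mul1r lerDl.
have n0 : 0 < n.+1%:R :> R by rewrite ltr0n.
rewrite -(natr1 n.+1) -(ler_pM2l n0).
have := sqr_ge0 (n.+1%:R * D - E).
by move: (n.+1%:R) n0 Eg => N n0 Eg; nra.
Qed.

(* The displacements of the factors add up to that of the composition; [g] is
   the sum of their squared norms. *)
Lemma foldl_averaged (I : Type) (V : I -> H -> H) (c : R) (s : seq I) x y :
  (forall i, rho_averaged c (V i)) ->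
  let W := fun z => foldl (fun u i => V i u) z s in
  exists g, [/\ 0 <= g, `|W x - W y| ^+ 2 <= `|x - y| ^+ 2 - c * g &
    `|(x - W x) - (y - W y)| ^+ 2 <= (size s)%:R * g].
Proof.
move=> Vc; elim: s x y => [|i s IHs] x y /=.
  by exists 0; split; rewrite ?mulr0 ?subr0 // !subrr normr0 expr0n.
have [g [g0 Wg dg]] := IHs (V i x) (V i y).
set W := foldl _ in Wg dg *.
exists (`|(x - V i x) - (y - V i y)| ^+ 2 + g); split.
- by rewrite addr_ge0 ?sqr_ge0.
- by have := Vc i x y; lra.
- apply: le_trans (sqrD_le_weighted _ g0 dg).
  rewrite ler_pXn2r ?nnegrE ?addr_ge0 //.
  apply: le_trans (ler_normD _ _).
  by rewrite addrACA -opprD !subrKA.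
Qed.

(** The total [g] of a string is at least q^-1 times its squared displacement; this loss is the
    factor M^-1 in [rho_U]. *)
Lemma string_op_averaged m (U : 'I_m.+1 -> H -> H) (c : R) q
    (t : {ffun 'I_q -> 'I_m.+1}) : (0 < q)%N -> 0 <= c ->
  (forall i, rho_averaged c (U i)) -> rho_averaged (q%:R^-1 * c) (string_op U t).
Proof.
move=> q0 c0 Uc x y.
have [g [g0]] := foldl_averaged (enum 'I_q) x y (fun j => Uc (t j)).
rewrite size_enum_ord => Wg dg.
apply: le_trans Wg _; rewrite lerD2l lerN2 -mulrA mulrCA ler_wpM2l //.
by rewrite ler_pdivrMl ?ltr0n.
Qed.

(** Convexity of the squared norm is used twice, for the differences of images and, through
    [0 <= rho], for the displacements; the inequalities of the strings are then averaged. *)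
Lemma string_avg_averaged m (U : 'I_m.+1 -> H -> H) (rho : R) q
    (Omega : {set {ffun 'I_q -> 'I_m.+1}}) omega : 0 <= rho ->
  (forall t, t \in Omega -> 0 <= omega t) -> \sum_(t in Omega) omega t = 1 ->
  (forall t, t \in Omega -> rho_averaged rho (string_op U t)) ->
  rho_averaged rho (string_avg U Omega omega).
Proof.
move=> rho0 om0 om1 Vrho x y; rewrite /string_avg.
have conv z : z = \sum_(t in Omega) omega t *: z.
  by rewrite -scaler_suml om1 scale1r.
have cvx (F : {ffun 'I_q -> 'I_m.+1} -> H) :=
  sqnorm_convex_sum h_ip F om0 om1.
rewrite -sumrB.
(* Writing [x] and [y] as averages of themselves makes the displacement a convex sum. *)
rewrite [X in (X - _) - _]conv [X in _ - (X - _)]conv -!sumrB.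
under eq_bigr do rewrite -scalerBr.
under [X in _ - _ * `|X| ^+ 2]eq_bigr do rewrite -!scalerBr.
apply: le_trans (cvx _) _.
apply: le_trans (lerB (lexx _) (ler_wpM2l rho0 (cvx _))).
rewrite -[X in _ <= X - _]mul1r -om1 mulr_suml mulr_sumr -sumrB.
apply: ler_sum => t tO; rewrite (mulrCA rho) -mulrBr.
by rewrite ler_wpM2l ?om0 // Vrho.
Qed.

Lemma relaxation_bound_ge0 m (alpha : 'I_m.+1 -> R) :
  (forall i, 0 < alpha i <= 2) ->
  0 <= \big[Num.min/((2 - alpha ord0) / alpha ord0)]_(i < m.+1)
    ((2 - alpha i) / alpha i).
Proof.
move=> ha; have c0 i : 0 <= (2 - alpha i) / alpha i.
  by case/andP: (ha i) => a0 a2; rewrite divr_ge0 ?subr_ge0 // ltW.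
exact: le_bigmin.
Qed.

Lemma rho_U_ge0 m (alpha : 'I_m.+1 -> R) M :
  (forall i, 0 < alpha i <= 2) -> 0 <= rho_U alpha M.
Proof.
move=> ha; rewrite /rho_U le_min ler01 andbT mulr_ge0 ?invr_ge0 //.
exact: relaxation_bound_ge0.
Qed.

Lemma rho_U_averaged m (alpha : 'I_m.+1 -> R) (U : 'I_m.+1 -> H -> H) M q
    (Omega : {set {ffun 'I_q -> 'I_m.+1}}) omega :
  (forall i, 0 < alpha i <= 2) ->
  (forall i, relaxed_firmly_nonexpansive ip (alpha i) (U i)) ->
  (0 < q <= M)%N ->
  (forall t, t \in Omega -> 0 <= omega t) -> \sum_(t in Omega) omega t = 1 ->
  rho_averaged (rho_U alpha M) (string_avg U Omega omega).
Proof.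
move=> ha hU /andP[q0 qM] om0 om1.
apply: string_avg_averaged => //; first exact: rho_U_ge0.
set c : R := \big[Num.min/((2 - alpha ord0) / alpha ord0)]_(i < m.+1)
  ((2 - alpha i) / alpha i).
have c0 : 0 <= c by exact: relaxation_bound_ge0.
move=> t _; apply: rho_averaged_le (string_op_averaged t q0 c0 _).
  (* As [q <= M], M^-1 <= q^-1, so one constant serves all string lengths. *)
  rewrite /rho_U -/c ge_min; apply/orP; left.
  by rewrite ler_wpM2r // lef_pV2 ?posrE ?ltr0n ?(leq_trans q0) // ler_nat.
move=> i; apply: rho_averaged_le (relaxed_rho_averaged _ (hU i)).
  exact: bigmin_le.
by case/andP: (ha i).
Qed.

(* With the relaxation parameter in [[eps, 1 + rho - eps]] the coefficient
   [lambda * (1 + rho - lambda)] is at least [eps ^+ 2]. *)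
Lemma relaxed_step_le (rho eps lam : R) T w z : 0 < eps ->
  eps <= lam <= 1 + rho - eps -> rho_averaged rho T -> Fix T z ->
  `|w + lam *: (T w - w) - z| ^+ 2 <=
    `|w - z| ^+ 2 - eps ^+ 2 * `|T w - w| ^+ 2.
Proof.
move=> e0 /andP[l1 l2] Trho Tz; have := Trho w z; rewrite Tz subrr subr0.
have -> : T w - z = (w - z) + (T w - w) by rewrite [RHS]addrC subrKA.
have -> : w + lam *: (T w - w) - z = (w - z) + lam *: (T w - w) by rewrite addrAC.
rewrite (distrC w (T w)) !(sqnormD h_ip (w - z)) (sqnormZ h_ip) ipZr.
set a := `|T w - w| ^+ 2; set b := ip _ _; set d := `|w - z| ^+ 2 => hb.
have hl : eps ^+ 2 <= lam * (1 + rho - lam).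
  by rewrite expr2; apply: ler_pM; lra.
have := ler_wpM2r (sqr_ge0 _ : 0 <= a) hl.
have := ler_wpM2l (ltW (lt_le_trans e0 l1)) hb.
lra.
Qed.

End averaged_operators.

(** * Convergence along filters and ultrafilters *)

Lemma cvg_sqr (R : realType) (X : Type) (F : set_system X) (u : X -> R)
    (a : R) : Filter F -> u @ F --> a -> u k ^+ 2 @[k --> F] --> a ^+ 2.
Proof.
by move=> FF ua; rewrite expr2; under eq_fun do rewrite expr2; exact: cvgM.
Qed.

(** If [F] missed the preimage of [V], its trace on the complement would be proper, and an
    ultrafilter refining that trace would contain both the preimage and its complement. *)
Lemma cvg_ultra (X : Type) (T : topologicalType) (F : set_system X) (u : X -> T)
    (a : T) : ProperFilter F ->
  (forall G, UltraFilter G -> F `<=` G -> u @ G --> a) -> u @ F --> a.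
Proof.
move=> FF uG V Va; apply: contrapT => nFV.
pose D := ~` (u @^-1` V).
have DF : ProperFilter (within D F).
  refine (Build_ProperFilter _ (within_filter D _)).
  move=> F0; apply: nFV; move: F0; rewrite /within /= => F0.
  by apply: filterS F0 => k Dk; apply: contrapT => nVk; exact: Dk.
have [G [GU FG]] := ultraFilterLemma DF.
have GD : G D by apply: FG; rewrite /within /=; apply: filterS filterT => k.
have GV : G (u @^-1` V).
  apply: (uG G GU _ V Va) => A FA; apply: FG.
  by rewrite /within /=; apply: filterS FA => k Ak _.
by have [k [Dk Vk]] := filter_ex (filterI GD GV).
Qed.

(** The interval [-B, B] is compact, and a cluster point of an ultrafilter is a limit. *)
Lemma bounded_ultra_cvg (R : realType) (X : Type) (F : set_system X)
    (u : X -> R) (B : R) : UltraFilter F -> (forall k, `|u k| <= B) ->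
  exists a : R, u @ F --> a.
Proof.
move=> FU uB.
have uFB : (u @ F) `[-B, B]%classic.
  apply: (@filterS _ F _ setT) filterT => k _.
  by rewrite /= in_itv /= -ler_norml uB.
have [a [_ clua]] := @segment_compact R (-B) B (u @ F) _ uFB.
exists a => V Va; have [//|FnV] := in_ultra_setVsetC (u @^-1` V) FU.
by have [t [nVt Vt]] := clua (~` V) V FnV Va.
Qed.

Lemma cvgn_near_points (R : realType) (H : completeNormedModType R)
    (x : nat -> H) :
  (forall e : R, 0 < e -> exists a, \forall n \near \oo, `|a - x n| < e) ->
  cvgn x.
Proof.
move=> xC; apply: cauchy_cvg; apply: cauchy_exP => e e0.
by have [a ae] := xC e e0; exists a; rewrite -ball_normE.
Qed.

(** * Riesz representation, weak limits along ultrafilters, demiclosedness, Opial's argument *)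

Section weak_limits.
Context {R : realType} {H : completeNormedModType R} (ip : {dot H for idfun}).
Hypothesis h_ip : induces_norm ip.

(* The representing vector minimizes [`|x| ^+ 2 - 2 * f x]; minimizing
   sequences are Cauchy by the parallelogram identity. *)
Lemma riesz_representation (f : H -> R) (B : R) :
  (forall x y, f (x + y) = f x + f y) -> (forall a x, f (a *: x) = a * f x) ->
  (forall x, `|f x| <= B * `|x|) -> exists l, forall z, f z = ip l z.
Proof.
move=> fD fZ fB; pose g x := `|x| ^+ 2 - 2 * f x.
have g_lb x : - B ^+ 2 <= g x.
  have := fB x; rewrite ler_norml => /andP[_ fx].
  have := sqr_ge0 (`|x| - B); rewrite /g; nra.
have gI : has_inf (range g).
  by split; [exists (g 0), 0 | exists (- B ^+ 2) => _ [x _ <-]].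
pose m := inf (range g).
have gm x : m <= g x by apply: ge_inf; [case: gI | exists x].
have /choice[x xm] n : exists x, g x < m + n.+1%:R^-1.
  have n0 : 0 < n.+1%:R^-1 :> R by rewrite invr_gt0.
  have [_ [x _ <-] gx] := inf_adherent n0 gI.
  by exists x.
(* |a - b|^2 equals 2 g a + 2 g b minus four times [g] at the midpoint, where [g] is at least
   [m]. *)
have dist_le a b : `|a - b| ^+ 2 <= 2 * (g a - m) + 2 * (g b - m).
  have := gm (2^-1 *: (a + b)).
  rewrite /g (sqnormZ h_ip) fZ fD (sqnormD h_ip) (sqnormB h_ip).
  have -> : (2^-1 : R) ^+ 2 = 4^-1 by rewrite exprVn -natrX.
  lra.
have xcvg : cvgn x.
  apply: cvgn_near_points => e e0.
  have e4 : 0 < e ^+ 2 / 4 by rewrite divr_gt0 ?exprn_gt0.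
  have [N _ hN] := near_infty_natSinv_lt (PosNum e4).
  exists (x N); exists N => // n /= Nn.
  rewrite -(@ltr_pXn2r _ 2) ?nnegrE ?(ltW e0) //.
  apply: le_lt_trans (dist_le _ _) _.
  have invN k : (N <= k)%N -> k.+1%:R^-1 < e ^+ 2 / 4 by move=> /hN.
  have := invN _ (leqnn N); have := invN _ Nn; have := xm n; have := xm N.
  move: (_^-1) (_^-1) (g _) (g _) => a b c d; lra.
have [l xl] := (cvg_ex _).1 xcvg.
exists l => z; apply/esym/eqP; rewrite -subr_eq0; apply/eqP.
set c := ip l z - f z.
have ipl : ip (x n) z @[n --> \oo] --> ip l z.
  apply/cvgrPdist_le => e e0.
  have e1 : 0 < e / (`|z| + 1) by rewrite divr_gt0 // ltr_wpDl.
  move/cvgrPdist_le: xl => /(_ _ e1); apply: filterS => n xln.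
  rewrite -ipBl; apply: le_trans (cauchy_schwarz h_ip _ _) _.
  move: xln; rewrite ler_pdivlMr ?ltr_wpDl // => xln; apply: le_trans xln.
  by rewrite ler_wpM2l // lerDl.
pose N := `|z| ^+ 2.
have N0 : 0 <= N by exact: sqr_ge0.
(* First variation: the quadratic is the limit of g (x n + t z) - g (x n) + 1/(n+1), nonnegative
   because [x n] minimizes [g] up to 1/(n+1). *)
have var t : 0 <= 2 * t * c + t ^+ 2 * N.
  have lim0 : 2 * t * (ip (x n) z - f z) + t ^+ 2 * N + n.+1%:R^-1
      @[n --> \oo] --> 2 * t * c + t ^+ 2 * N + 0.
    apply: cvgD; last exact: cvg_harmonic.
    by apply: cvgD (cvg_cst _); apply: cvgMl_tmp; apply: cvgB ipl (cvg_cst _).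
  rewrite -[X in _ <= X]addr0; apply: (cvgr_to_ge lim0); apply: nearW => n.
  have := gm (x n + t *: z); have := xm n.
  rewrite /g (sqnormD h_ip) (sqnormZ h_ip) ipZr fD fZ -/N.
  move: (_^-1) => a; lra.
(* The choice - c / N would be optimal; [N + 1] avoids dividing by zero when [z = 0], and the value
   is still negative unless [c = 0]. *)
have := var (- c / (N + 1)).
have N1 : 0 < N + 1 by lra.
have -> : 2 * (- c / (N + 1)) * c + (- c / (N + 1)) ^+ 2 * N =
  - (c ^+ 2 * (N + 2) / (N + 1) ^+ 2) by field; rewrite gt_eqF.
rewrite oppr_ge0 pmulr_lle0 ?invr_gt0 ?exprn_gt0 // pmulr_lle0; last lra.
by move=> c0; apply/eqP; rewrite -sqrf_eq0 eq_le c0 sqr_ge0.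
Qed.

Definition weakly_cvg_along (X : Type) (F : set_system X) (x : X -> H) (l : H) :=
  forall z, ip (x k) z @[k --> F] --> ip l z.

(** Each [ip (x k) z] is bounded, so it converges along [F]; the limit is linear in [z] and bounded
    by B |z|, hence represented by a vector. *)
Lemma ultra_weakly_cvg (X : Type) (F : set_system X) (x : X -> H) (B : R) :
  UltraFilter F -> (forall k, `|x k| <= B) -> exists l, weakly_cvg_along F x l.
Proof.
move=> FU xB.
have ipB k z : `|ip (x k) z| <= B * `|z|.
  by apply: le_trans (cauchy_schwarz h_ip _ _) _; rewrite ler_wpM2r.
have /choice[f fF] z : exists a : R, ip (x k) z @[k --> F] --> a.
  exact: (bounded_ultra_cvg FU (fun k => ipB k z)).
have fE z a : ip (x k) z @[k --> F] --> a -> f z = a.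
  by move=> xa; apply: cvg_unique (fF z) xa.
have [||z|l fl] := @riesz_representation f B.
- move=> z1 z2; apply: fE.
  by under eq_fun do rewrite ipDr; apply: cvgD; exact: fF.
- move=> a z; apply: fE.
  by under eq_fun do rewrite ipZr; apply: cvgMl_tmp; exact: fF.
- have fz : `|ip (x k) z| @[k --> F] --> `|f z| by exact: cvg_norm (fF z).
  apply: (cvgr_to_le (F := F) fz); apply: nearW => k; exact: ipB.
- by exists l => z; rewrite -fl; exact: fF.
Qed.

(** Demiclosedness principle: |x k - S l| exceeds |x k - l| by at most |S (x k) - x k|, while weak
    convergence makes |x k - S l|^2 - |x k - l|^2 tend to |l - S l|^2. *)
Lemma demiclosed (X : Type) (F : set_system X) (x : X -> H) (B : R) (l : H)
    (S : H -> H) : ProperFilter F -> (forall k, `|x k| <= B) ->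
  (forall u v, `|S u - S v| <= `|u - v|) -> weakly_cvg_along F x l ->
  `|S (x k) - x k| @[k --> F] --> (0 : R) -> Fix S l.
Proof.
move=> FF xB Sne xl Sx.
have le_k k : `|l - S l| ^+ 2 <= `|S (x k) - x k| ^+ 2 +
    2 * (B + `|l|) * `|S (x k) - x k| + 2 * (ip l (l - S l) - ip (x k) (l - S l)).
  have h1 : `|x k - S l| <= `|S (x k) - x k| + `|x k - l|.
    rewrite -[x k - S l](subrKA (S (x k))) -(distrC (x k)).
    by apply: le_trans (ler_normD _ _) _; rewrite lerD2l.
  have h2 : `|x k - l| <= B + `|l|.
    by apply: le_trans (ler_normB _ _) _; rewrite lerD2r.
  have h3 : `|x k - S l| ^+ 2 = `|x k - l| ^+ 2 +
      2 * (ip (x k) (l - S l) - ip l (l - S l)) + `|l - S l| ^+ 2.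
    by rewrite -[x k - S l](subrKA l) (sqnormD h_ip (x k - l)) ipBl.
  have := normr_ge0 (x k - S l); have := normr_ge0 (S (x k) - x k).
  have := normr_ge0 (x k - l).
  nra.
have cvg_bound : `|S (x k) - x k| ^+ 2 + 2 * (B + `|l|) * `|S (x k) - x k| +
    2 * (ip l (l - S l) - ip (x k) (l - S l)) @[k --> F] -->
    0 ^+ 2 + 2 * (B + `|l|) * 0 + 2 * (ip l (l - S l) - ip l (l - S l)).
  apply: cvgD; first apply: cvgD.
  - exact: cvg_sqr.
  - exact: cvgMl_tmp.
  - by apply: cvgMl_tmp; apply: cvgB (xl _); exact: cvg_cst.
have := cvgr_to_ge cvg_bound (nearW _ le_k).
rewrite subrr !mulr0 expr0n !addr0 => h0; apply/eqP; rewrite eq_sym -subr_eq0.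
by rewrite -normr_eq0 -sqrf_eq0 eq_le h0 sqr_ge0.
Qed.

(* Two weak cluster points [l] and [l'] in [C] coincide because the convergence
   of [`|y k - l|] and [`|y k - l'|] forces that of [ip (y k) (l - l')]. *)
Lemma opial_weakly_converges (C : set H) (y : nat -> H) (B : R) :
  (forall k, `|y k| <= B) -> (forall c, C c -> cvgn (fun k => `|y k - c|)) ->
  (forall F l, UltraFilter F -> \oo `<=` F -> weakly_cvg_along F y l -> C l) ->
  exists2 l, C l & weakly_converges ip y l.
Proof.
move=> yB yC clC.
have [F [FU ooF]] := ultraFilterLemma (F := \oo : set_system nat) _.
have [l yl] := ultra_weakly_cvg FU yB.
have Cl := clC F l FU ooF yl; exists l => // z.
(* Along every ultrafilter [G] refining [\oo] the sequence has a weak limit [l'], so it is enough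
   that [l = l']. *)
apply: cvg_ultra => G GU ooG.
have [l' yl'] := ultra_weakly_cvg GU yB.
suff -> : l = l' by exact: yl'.
have Cl' := clC G l' GU ooG yl'.
have [d yd] := (cvg_ex _).1 (yC l Cl); have [d' yd'] := (cvg_ex _).1 (yC l' Cl').
have ipE k : ip (y k) (l - l') =
    (`|y k - l'| ^+ 2 - `|y k - l| ^+ 2 - (`|l'| ^+ 2 - `|l| ^+ 2)) / 2.
  by rewrite !(sqnormB h_ip) ipBr; field.
have cvg_ip : ip (y k) (l - l') @[k --> \oo] -->
    (d' ^+ 2 - d ^+ 2 - (`|l'| ^+ 2 - `|l| ^+ 2)) / 2.
  under eq_fun do rewrite ipE.
  apply: cvgMr_tmp; apply: cvgB (cvg_cst _).
  by apply: cvgB; exact: cvg_sqr.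
have sub_cvg (K : set_system nat) (u : nat -> R) (a : R) :
    \oo `<=` K -> u @ \oo --> a -> u @ K --> a.
  by move=> ooK ua V Va; apply: ooK; exact: ua.
set v := (X in _ --> X) in cvg_ip.
have e1 : ip l (l - l') = v.
  by apply: cvg_unique (yl (l - l')) (sub_cvg F _ _ ooF cvg_ip).
have e2 : ip l' (l - l') = v.
  by apply: cvg_unique (yl' (l - l')) (sub_cvg G _ _ ooG cvg_ip).
apply/eqP; rewrite -subr_eq0 -normr_eq0 -sqrf_eq0 h_ip ipBl.
by rewrite e1 e2 subrr.
Qed.

End weak_limits.

(** * Quasi-Fejer sequences of real numbers *)

Section quasi_fejer.
Context {R : realType}.
Variables (a b : nat -> R).
Hypothesis ab : forall k, a k.+1 <= a k + b k.

Lemma quasi_fejer_tail k n :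
  (k <= n)%N -> a n <= a k + (series b n - series b k).
Proof.
move=> kn; rewrite -(subnK kn); elim: (n - k)%N => [|i IHi].
  by rewrite add0n subrr addr0.
rewrite addSn; apply: le_trans (ab _) _.
have <- := seriesSB b (i + k); lra.
Qed.

(** [a - series b] is nonincreasing, and bounded below since [a] is nonnegative and the partial sums
    are bounded above. *)
Lemma quasi_fejer_cvg :
  (forall k, 0 <= a k) -> cvgn (series b) -> cvgn a.
Proof.
move=> a0 cb; pose u := a - series b.
have -> : a = u + series b by rewrite /u subrK.
apply: is_cvgD => //; apply: nonincreasing_is_cvgn.
  move=> k n kn; rewrite /u /= !fctE; have := quasi_fejer_tail kn; lra.
have [B hB] := bounded_fun_has_ubound (cvg_seq_bounded cb).
exists (- B) => _ [n _ <-]; have := a0 n.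
have : series b n <= B by apply: hB; exists n.
by rewrite /u !fctE; lra.
Qed.

End quasi_fejer.

(** * Averaged iterations with summable perturbations *)

Section perturbed_iteration.
Context {R : realType} {H : completeNormedModType R} (ip : {dot H for idfun}).
Hypothesis h_ip : induces_norm ip.
Variables (T : nat -> H -> H) (rho eps : R) (lambda b : nat -> R).
Variables (y w : nat -> H).
Hypothesis rho_ge0 : 0 <= rho.
Hypothesis T_averaged : forall k, rho_averaged rho (T k).
Hypothesis T_adm : limsup_admissible T.
Hypothesis eps_gt0 : 0 < eps.
Hypothesis lambda_bounds : forall k, eps <= lambda k <= 1 + rho - eps.
Hypothesis b_summable : cvgn (series b).
Hypothesis w_near_y : forall k, `|w k - y k| <= b k.
Hypothesis y_step : forall k, y k.+1 = w k + lambda k *: (T k (w k) - w k).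

Let C := \bigcap_(S in limsup_op T) Fix S.

Hypothesis C_neq0 : C !=set0.

Let b_ge0 k : 0 <= b k.
Proof. by apply: le_trans (w_near_y k). Qed.

Let b_cvg0 : b @ \oo --> 0.
Proof. exact: cvg_series_cvg_0. Qed.

Let w_dist k z : `|w k - z| <= `|y k - z| + b k.
Proof.
rewrite -(subrKA (y k)) addrC.
by apply: le_trans (ler_normD _ _) _; rewrite lerD2l.
Qed.

Let step_le k z : C z ->
  `|y k.+1 - z| ^+ 2 <= `|w k - z| ^+ 2 - eps ^+ 2 * `|T k (w k) - w k| ^+ 2.
Proof.
move=> Cz; rewrite y_step.
apply: (relaxed_step_le h_ip (w k) eps_gt0 (lambda_bounds k) (T_averaged k)).
(* By admissibility every [T k] lies in the limsup, so [z] is fixed by [T k]. *)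
by apply: Cz; case: T_adm.
Qed.

Lemma iterate_quasi_fejer k z : C z -> `|y k.+1 - z| <= `|y k - z| + b k.
Proof.
move=> Cz; apply: le_trans (w_dist k z).
rewrite -(@ler_pXn2r _ 2) ?nnegrE //; apply: le_trans (step_le k Cz) _.
by rewrite gerBl mulr_ge0 ?sqr_ge0.
Qed.

Lemma iterate_dist_cvg z : C z -> cvgn (fun k => `|y k - z|).
Proof.
move=> Cz; apply: (@quasi_fejer_cvg _ _ b) => // k.
exact: iterate_quasi_fejer.
Qed.

Lemma iterate_bounded : exists B, forall k, `|y k| <= B.
Proof.
have [z Cz] := C_neq0.
have [B hB] := bounded_fun_has_ubound (cvg_seq_bounded (iterate_dist_cvg Cz)).
exists (B + `|z|) => k; rewrite -[y k](subrK z).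
apply: le_trans (ler_normD _ _) _; rewrite lerD2r.
by apply: hB; exists k.
Qed.

(** For [z] in [C], eps^2 |T k (w k) - w k|^2 is at most (|y k - z| + b k)^2 - |y k.+1 - z|^2, and
    both squares have the same limit. *)
Lemma operator_displacement_cvg0 :
  `|T k (w k) - w k| @[k --> \oo] --> (0 : R).
Proof.
have [z Cz] := C_neq0; have [d yd] := (cvg_ex _).1 (iterate_dist_cvg Cz).
pose u k := ((`|y k - z| + b k) ^+ 2 - `|y k.+1 - z| ^+ 2) / eps ^+ 2.
have e2 : 0 < eps ^+ 2 by exact: exprn_gt0.
have u0 : u @ \oo --> 0.
  rewrite (_ : 0 = ((d + 0) ^+ 2 - d ^+ 2) / eps ^+ 2); last first.
    by rewrite addr0 subrr mul0r.
  have ydS : `|y k.+1 - z| @[k --> \oo] --> d.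
    by rewrite (cvg_shiftS (fun k => `|y k - z|)).
  by apply: cvgMr_tmp; apply: cvgB; apply: cvg_sqr => //; exact: cvgD.
have su0 : Num.sqrt (u k) @[k --> \oo] --> (0 : R).
  rewrite -sqrtr0; apply: continuous_cvg => //; exact: sqrt_continuous.
apply: (squeeze_cvgr _ (cvg_cst 0) su0); apply: nearW => k.
rewrite normr_ge0 /= -[leLHS]ger0_norm // -sqrtr_sqr ler_wsqrtr //.
rewrite /u ler_pdivlMr // mulrC.
have := step_le k Cz.
have : `|w k - z| ^+ 2 <= (`|y k - z| + b k) ^+ 2.
  by rewrite ler_pXn2r ?nnegrE ?addr_ge0 // w_dist.
lra.
Qed.

Lemma iterate_step_cvg0 : `|y k.+1 - y k| @[k --> \oo] --> (0 : R).
Proof.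
have lim0 : b k + (1 + rho) * `|T k (w k) - w k| @[k --> \oo] -->
    0 + (1 + rho) * 0.
  by apply: cvgD => //; apply: cvgMl_tmp; exact: operator_displacement_cvg0.
rewrite mulr0 addr0 in lim0.
apply: (squeeze_cvgr _ (cvg_cst 0) lim0); apply: nearW => k.
rewrite normr_ge0 /= y_step addrAC.
apply: le_trans (ler_normD _ _) _; rewrite lerD // normrZ.
have /andP[l1 l2] := lambda_bounds k.
rewrite ler_wpM2r // ger0_norm; first by rewrite (le_trans l2) // gerBl ltW.
by rewrite (le_trans _ l1) // ltW.
Qed.

Lemma limsup_op_nonexpansive S u v : limsup_op T S -> `|S u - S v| <= `|u - v|.
Proof.
move=> IS; have [N N0 hN] := T_adm.2 S IS.
by have [j _ ->] := hN 0; exact: rho_averaged_nonexpansive rho_ge0 (T_averaged j).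
Qed.

(* [S] is applied to some [w j] with [j] within a bounded distance of [k], and
   [w j] is close to [y k]. *)
Lemma limsup_op_displacement_cvg0 S : limsup_op T S ->
  `|S (y k) - y k| @[k --> \oo] --> (0 : R).
Proof.
move=> IS; have [N N0 hN] := T_adm.2 S IS.
have lim0 : b k + `|T k (w k) - w k| + `|y k.+1 - y k| @[k --> \oo] -->
    (0 + 0 + 0 : R).
  apply: cvgD; last exact: iterate_step_cvg0.
  by apply: cvgD => //; exact: operator_displacement_cvg0.
rewrite !addr0 in lim0.
apply/cvgr0Pnorm_le => e e0.
(* With each small quantity at most d = e / c, |w j - y k| <= (N + 1) d; this counts twice, [S]
   being nonexpansive, and |S (w j) - w j| <= d brings the total to (2 N + 3) d. *)
pose c : R := 2 * N%:R + 3.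
have c0 : 0 < c by rewrite ltr_wpDl // mulr_ge0.
have d0 : 0 < e / c by exact: divr_gt0.
have [K _ hK] := cvgr0_norm_le _ lim0 _ d0.
have {}hK k : (K <= k)%N ->
    [/\ b k <= e / c, `|T k (w k) - w k| <= e / c & `|y k.+1 - y k| <= e / c].
  move=> Kk; have /= := hK k Kk; rewrite ger0_norm ?addr_ge0 //.
  have := b_ge0 k; have := normr_ge0 (T k (w k) - w k).
  have := normr_ge0 (y k.+1 - y k).
  by move: (e / c) => d *; split; lra.
have drift k i : (K <= k)%N -> `|y (i + k)%N - y k| <= i%:R * (e / c).
  move=> Kk; elim: i => [|i IHi]; first by rewrite add0n subrr normr0 mul0r.
  rewrite addSn -(subrKA (y (i + k)%N)) -natr1 mulrDl mul1r addrC.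
  apply: le_trans (ler_normD _ _) _; rewrite lerD //.
  by have [] := hK (i + k)%N (leq_trans Kk (leq_addl _ _)).
exists K => // k /= Kk; rewrite normr_id.
have [j /andP[kj jN] Sj] := hN k.
have [bj Tj _] := hK j (leq_trans Kk kj).
have yj : `|y j - y k| <= N%:R * (e / c).
  rewrite -(subnK kj); apply: le_trans (drift _ _ Kk) _.
  by rewrite ler_wpM2r ?(ltW d0) // ler_nat leq_subLR ltnW.
have wj : `|w j - y k| <= e / c + N%:R * (e / c).
  rewrite -(subrKA (y j)); apply: le_trans (ler_normD _ _) _.
  by rewrite lerD // (le_trans (w_near_y j)).
have -> : S (y k) - y k = (S (y k) - S (w j)) + ((S (w j) - w j) + (w j - y k)).
  by rewrite !subrKA.
have := limsup_op_nonexpansive (y k) (w j) IS; rewrite (distrC (y k)) => Sw.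
apply: le_trans (ler_normD _ _) _.
have tri := ler_normD (S (w j) - w j) (w j - y k).
rewrite -Sj in Tj.
have eE : e = (2 * N%:R + 3) * (e / c) by rewrite mulrCA divff ?mulr1 // gt_eqF.
rewrite [leRHS]eE; move: (e / c) wj Tj => d wj Tj; lra.
Qed.

Lemma perturbed_iteration_weakly_converges :
  exists2 l, C l & weakly_converges ip y l.
Proof.
have [B yB] := iterate_bounded.
apply: (opial_weakly_converges h_ip yB iterate_dist_cvg).
move=> F l FU ooF yl S IS.
apply: (demiclosed h_ip _ yB _ yl) => [u v|].
  exact: limsup_op_nonexpansive.
by move=> V V0; apply: ooF; exact: limsup_op_displacement_cvg0.
Qed.

Lemma perturbed_iteration_converges :
  (forall S, limsup_op T S -> approximately_shrinking S) ->
  boundedly_regular (limsup_op T) Fix -> exists2 l, C l & y @ \oo --> l.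
Proof.
move=> shrink [_ _ _ breg].
have [B yB] := iterate_bounded.
have y_bounded : bounded_fun y.
  exists B; split; first exact: num_real.
  by move=> M BM k _; rewrite /= (le_trans (yB k)) ?ltW.
have dist0 : dist_set (y k) C @[k --> \oo] --> 0%E.
  apply: breg => // S IS; apply: (shrink S IS).2 => //.
  exact: limsup_op_displacement_cvg0.
(* Choose [K] with d(y K, C) < e / 2 and the partial sums of [b] within e / 4 of their limit from
   [K] on: some [c] in [C] is within e / 2 of [y K], and later perturbations add less than e / 2. *)
have near_C (e : R) : 0 < e ->
    exists2 c, C c & exists K, forall n, (K <= n)%N -> `|c - y n| < e.
  move=> e0; have e2 : 0 < e / 2 by rewrite divr_gt0.
  have [s bs] := (cvg_ex _).1 b_summable.
  have e4 : 0 < e / 4 by rewrite divr_gt0.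
  have near_s : \forall k \near \oo, `|s - series b k| < e / 4.
    exact: (cvgr_dist_lt _ _ bs _ e4).
  have near_dist : \forall k \near \oo, (dist_set (y k) C < (e / 2)%:E)%E.
    have [fin_dist fine_dist] := (fine_cvgP _ _).1 dist0.
    apply: filterS (filterI fin_dist (cvgr0_norm_lt _ fine_dist _ e2)) => k [dk /= ltk]; rewrite -(fineK dk) lte_fin.
    exact: le_lt_trans (ler_norm _) ltk.
  have [K _ hK] := filterI near_dist near_s.
  have [/ereal_inf_lt[_ [c Cc <-]] + _] := hK K (leqnn K).
  rewrite lte_fin => cK; exists c => //; exists K => n Kn.
  have := quasi_fejer_tail (fun k => iterate_quasi_fejer k Cc) Kn.
  have [_ +] := hK n Kn; have [_ +] := hK K (leqnn K).
  rewrite (distrC c) /= !ltr_norml => /andP[? ?] /andP[? ?].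
  lra.
have ycvg : cvgn y.
  apply: cvgn_near_points => e /near_C[c _ [K hK]].
  by exists c; exists K => // n; exact: hK.
have [l yl] := (cvg_ex _).1 ycvg; exists l => // S IS.
(* The strong limit is fixed by [S]: going from [S l] to [l] through [S (y k)] and [y k] costs at
   most this vanishing quantity. *)
have lim0 : `|S (y k) - y k| + 2 * `|l - y k| @[k --> \oo] --> (0 + 2 * 0 : R).
  apply: cvgD; first exact: limsup_op_displacement_cvg0.
  apply: cvgMl_tmp; rewrite -(normr0 H); apply: cvg_norm; rewrite -(subrr l).
  by apply: cvgB yl; exact: cvg_cst.
have : `|S l - l| <= 0 + 2 * 0.
  apply: (cvgr_to_ge lim0); apply: nearW => k.
  have := ler_normD (S l - S (y k)) (S (y k) - l).
  have := ler_normD (S (y k) - y k) (y k - l); rewrite !subrKA (distrC (y k) l).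
  have := limsup_op_nonexpansive l (y k) IS; lra.
by rewrite mulr0 addr0 normr_le0 subr_eq0 => /eqP.
Qed.

End perturbed_iteration.

(** * The superiorized algorithm as a perturbed iteration *)

Lemma superiorized_direction_le1 (R : realType) (H : completeNormedModType R)
    (D : set H) (s v : H) :
  (~ D 0 -> v = - (`|s|^-1 *: s)) -> (D 0 -> v = 0) -> `|v| <= 1.
Proof.
move=> vN v0; have [/v0 ->|/vN ->] := EM (D 0); first by rewrite normr0.
rewrite normrN normrZ normfV normr_id.
(* For [s = 0] the norm is 0, the inverse of zero being zero by convention. *)
have [->|s0] := eqVneq s 0; first by rewrite normr0 mulr0.
by rewrite mulVf // normr_eq0.
Qed.

Lemma inner_iterate_dist (R : realType) (H : completeNormedModType R)
    (beta : nat -> nat -> R) (v : nat -> nat -> H) (y : nat -> H) k N :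
  (forall n, (1 <= n <= N)%N -> 0 < beta k n) ->
  (forall n, (1 <= n <= N)%N -> `|v k n| <= 1) ->
  `|inner_iterate beta v y k N - y k| <= \sum_(1 <= n < N.+1) beta k n.
Proof.
move=> beta0 v1; rewrite /inner_iterate addrAC subrr add0r.
apply: le_trans (ler_norm_sum _ _ _) _.
rewrite big_nat_cond [leRHS]big_nat_cond; apply: ler_sum => n.
rewrite andbT ltnS => nN.
by rewrite normrZ gtr0_norm ?beta0 // ler_piMr ?v1 // ltW ?beta0.
Qed.

Theorem corollary5p2 (R : realType) (H : completeNormedModType R)
    (ip : {dot H for idfun}) (h_ip : induces_norm ip)
    (phi : H -> R) (phi_convex : convex_function setT phi)
    (phi_cont : continuous phi)
    (m : nat) (alpha : 'I_m.+1 -> R) (U : 'I_m.+1 -> H -> H)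
    (h_alpha : forall i, 0 < alpha i <= 2)
    (h_U : forall i, relaxed_firmly_nonexpansive ip (alpha i) (U i))
    (q : nat -> nat) (q_gt0 : forall k, (0 < q k)%N)
    (M : nat) (h_M : is_max q M)
    (Omega : forall k, {set {ffun 'I_(q k) -> 'I_m.+1}})
    (Omega_neq0 : forall k, Omega k != finset.set0)
    (omega : forall k, {ffun 'I_(q k) -> 'I_m.+1} -> R)
    (h_omega : forall k t, t \in Omega k -> 0 < omega k t <= 1)
    (omega_sum1 : forall k, \sum_(t in Omega k) omega k t = 1)
    (T : nat -> H -> H)
    (T_def : forall k, T k = string_avg U (Omega k) (omega k))
    (y0 : H)
    (T_adm : limsup_admissible T)
    (C_neq0 : \bigcap_(S in limsup_op T) Fix S !=set0)
    (eps : R) (eps_gt0 : 0 < eps)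
    (lambda : nat -> R)
    (h_lambda : forall k, eps <= lambda k <= 1 + rho_U alpha M - eps)
    (y : nat -> H) (h_y : superiorized_GDSA ip phi T lambda y0 y) :
  (exists2 l, (\bigcap_(S in limsup_op T) Fix S) l & weakly_converges ip y l) /\
  ((forall S, limsup_op T S -> approximately_shrinking S) ->
   boundedly_regular (limsup_op T) Fix ->
   exists2 l, (\bigcap_(S in limsup_op T) Fix S) l & y @ \oo --> l).
Proof.
have [N [beta [s [v [N_gt0 beta_gt0 beta_sum [_ run]]]]]] := h_y.
(* The perturbed point; its distance to [y k] is bounded by the sum of the step sizes of the inner
   loop, which plays the role of [b k]. *)
pose w k := inner_iterate beta v y k (N k).
have v_le1 k n : (1 <= n <= N k)%N -> `|v k n| <= 1.
  case: n => [//|n] nN; have [_ vN v0] := (run k).1 n nN.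
  exact: superiorized_direction_le1 vN v0.
have w_near_y k : `|w k - y k| <= \sum_(1 <= n < (N k).+1) beta k n.
  by apply: inner_iterate_dist => n nN; [exact: beta_gt0 | exact: v_le1].
have y_step k : y k.+1 = w k + lambda k *: (T k (w k) - w k) := (run k).2.
have T_averaged k : rho_averaged (rho_U alpha M) (T k).
  rewrite T_def; apply: (rho_U_averaged h_ip h_alpha h_U) => //.
    by rewrite q_gt0 h_M.1.
  by move=> t /h_omega/andP[/ltW].
have rho_ge0 := rho_U_ge0 M h_alpha.
split.
  exact: (perturbed_iteration_weakly_converges h_ip rho_ge0 T_averaged T_adm
    eps_gt0 h_lambda beta_sum w_near_y y_step C_neq0).
exact: (perturbed_iteration_converges h_ip rho_ge0 T_averaged T_adm
  eps_gt0 h_lambda beta_sum w_near_y y_step C_neq0).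
Qed.
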